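(* Let $R$ be a commutative ring with nonzero identity, $M$ an $R$-module and $S$ a multiplicatively closed subset of $R$. If $M$ is a pseudo simple $R$-module and $\operatorname{ann}(m)\cap S=\emptyset$ for all $m\in M^{\#}$, then $S^{-1}M$ is a pseudo simple $S^{-1}R$-module.
   Context: For a commutative ring $A$ with identity, an $A$-module $M$ is called pseudo simple if the submodule $Am$ is simple for every $0\neq m\in M$ with $Am\neq M$. $M^{\#}=\{0\neq m\in M: Rm\neq M\}$, and $\operatorname{ann}(m)=\{r\in R: rm=0\}$. $S^{-1}M$ and $S^{-1}R$ are the usual localizations. The ring $R$ is not assumed to be a domain. *)

(* Defs.v *)
From HB Require Import structures.
From mathcomp Require Import all_boot all_algebra.
From mathcomp Require Import boolp classical_sets.
From mathcomp Require Import ring.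

Set Implicit Arguments.
Unset Strict Implicit.
Unset Printing Implicit Defensive.

Import GRing.Theory.

Local Open Scope ring_scope.
Local Open Scope classical_set_scope.
Local Open Scope quotient_scope.

(* The base rings below may be trivial, since S^-1 R is trivial when 0 \in S. *)

Definition cyclic_submod (A : comPzRingType) (M : lmodType A) (m : M) : set M :=
  [set a *: m | a in [set: A]].

Definition annihilator (A : comPzRingType) (M : lmodType A) (m : M) : set A :=
  [set a | a *: m = 0].

(* M^#: the nonzero elements that do not generate M *)
Definition nz_nongen (A : comPzRingType) (M : lmodType A) : set M :=
  [set m | m != 0 /\ cyclic_submod m <> [set: M]].
Arguments nz_nongen {A} M.

(* The submodules of a submodule N are the submodules of M contained in N. *)
Definition simple_submod (A : comPzRingType) (M : lmodType A) (N : set M) :=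
  [/\ submod_closed [in N], N <> [set 0]
    & forall L : set M, submod_closed [in L] -> L `<=` N ->
        L = [set 0] \/ L = N].

Definition pseudo_simple (A : comPzRingType) (M : lmodType A) :=
  forall m : M, nz_nongen M m -> simple_submod (cyclic_submod m).
Arguments pseudo_simple {A} M.

Section LocalizedGroup.
Variables (R : comNzRingType) (S : mulrClosed R) (M : lmodType R).

Definition denom := {s : R | s \in S}.

Definition denom_one : denom := exist _ 1 (rpred1 S).

Definition denom_mul (s t : denom) : denom :=
  exist _ (val s * val t) (rpredM (valP s) (valP t)).

(* The factor u is needed because elements of S may be zero divisors on M. *)
Definition loc_equiv (x y : M * denom) : bool :=
  `[< exists2 u, u \in S &
        u *: (val y.2 *: x.1) = u *: (val x.2 *: y.1) >].

Lemma loc_equiv_refl : reflexive loc_equiv.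
Proof. by move=> x; apply/asboolP; exists 1; first exact: rpred1. Qed.

Lemma loc_equiv_sym : symmetric loc_equiv.
Proof. by move=> x y; apply/asboolP/asboolP => -[u uS e]; exists u. Qed.

Lemma loc_equiv_trans : transitive loc_equiv.
Proof.
move=> [n [t tS]] [m [s sS]] [p [r rS]] /asboolP[/= u uS e] /asboolP[/= v vS f].
apply/asboolP; exists (u * v * t) => /=; first by rewrite !rpredM.
have -> : (u * v * t) *: (r *: m) = (v * r) *: (u *: (t *: m)).
  by rewrite !scalerA; congr (_ *: _); ring.
rewrite e.
have -> : (v * r) *: (u *: (s *: n)) = (u * s) *: (v *: (r *: n)).
  by rewrite !scalerA; congr (_ *: _); ring.
by rewrite f !scalerA; congr (_ *: _); ring.
Qed.

Canonical loc_equiv_equiv :=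
  EquivRel loc_equiv loc_equiv_refl loc_equiv_sym loc_equiv_trans.

(* S^-1 M *)
Definition locmod := {eq_quot loc_equiv}.

HB.instance Definition _ : EqQuotient _ loc_equiv locmod :=
  EqQuotient.on locmod.
HB.instance Definition _ := Choice.on locmod.

(* m / s *)
Definition locfrac (m : M) (s : denom) : locmod := \pi_locmod (m, s).

Lemma locfracP (m n : M) (s t : denom) :
  locfrac m s = locfrac n t <->
  exists2 u, u \in S & u *: (val t *: m) = u *: (val s *: n).
Proof.
split=> [/eqmodP/asboolP //|e].
by apply/eqmodP/asboolP.
Qed.

Lemma locfrac_surj (x : locmod) : exists m s, x = locfrac m s.
Proof.
by exists (repr x).1, (repr x).2; rewrite /locfrac -surjective_pairing reprK.
Qed.

Lemma repr_locfrac (m : M) (s : denom) :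
  exists2 u, u \in S & u *: (val s *: (repr (locfrac m s)).1)
                     = u *: (val (repr (locfrac m s)).2 *: m).
Proof.
by apply/locfracP; rewrite /locfrac -surjective_pairing reprK.
Qed.

Definition locmod_zero : locmod := locfrac 0 denom_one.

Definition locmod_opp (x : locmod) : locmod :=
  locfrac (- (repr x).1) (repr x).2.

Definition locmod_add (x y : locmod) : locmod :=
  locfrac (val (repr y).2 *: (repr x).1 + val (repr x).2 *: (repr y).1)
          (denom_mul (repr x).2 (repr y).2).

Lemma locmod_oppE (m : M) (s : denom) :
  locmod_opp (locfrac m s) = locfrac (- m) s.
Proof.
have [u uS e] := repr_locfrac m s.
by apply/locfracP; exists u => //; rewrite !scalerN e.
Qed.

Lemma locmod_addE (m n : M) (s t : denom) :
  locmod_add (locfrac m s) (locfrac n t) =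
  locfrac (val t *: m + val s *: n) (denom_mul s t).
Proof.
rewrite /locmod_add.
have [u uS e] := repr_locfrac m s; have [v vS f] := repr_locfrac n t.
move: (repr (locfrac _ s)) (repr (locfrac _ t)) e f => [m' [s' s'S]] [n' [t' t'S]] /= e f.
apply/locfracP; exists (u * v); first exact: rpredM.
case: s t e f => [s sS] [t tS] /= e f.
have -> : (u * v) *: ((s * t) *: (t' *: m' + s' *: n')) =
   (v * t * t') *: (u *: (s *: m')) + (u * s * s') *: (v *: (t *: n')).
  by rewrite !(scalerDr, scalerA); congr (_ *: _ + _ *: _); ring.
rewrite e f !(scalerDr, scalerA).
by congr (_ *: _ + _ *: _); ring.
Qed.

Lemma locmod_addA : associative locmod_add.
Proof.
move=> x y z.
have [m [s ->]] := locfrac_surj x; have [n [t ->]] := locfrac_surj y.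
have [p [r ->]] := locfrac_surj z.
rewrite !locmod_addE; apply/locfracP; exists 1; first exact: rpred1.
rewrite /= !(scalerDr, scalerA) addrA.
by congr (_ *: _ + _ *: _ + _ *: _); ring.
Qed.

Lemma locmod_addC : commutative locmod_add.
Proof.
move=> x y.
have [m [s ->]] := locfrac_surj x; have [n [t ->]] := locfrac_surj y.
rewrite !locmod_addE; apply/locfracP; exists 1; first exact: rpred1.
by rewrite addrC [val (denom_mul t s)]mulrC.
Qed.

Lemma locmod_add0 : left_id locmod_zero locmod_add.
Proof.
move=> x; have [m [s ->]] := locfrac_surj x.
rewrite locmod_addE; apply/locfracP; exists 1; first exact: rpred1.
by rewrite /= scaler0 add0r !scale1r mul1r.
Qed.

Lemma locmod_addN : left_inverse locmod_zero locmod_opp locmod_add.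
Proof.
move=> x; have [m [s ->]] := locfrac_surj x.
rewrite locmod_oppE locmod_addE; apply/locfracP; exists 1; first exact: rpred1.
by rewrite /= scalerN addNr !scaler0.
Qed.

HB.instance Definition _ :=
  GRing.isZmodule.Build locmod locmod_addA locmod_addC locmod_add0 locmod_addN.

Lemma locfracD (m n : M) (s t : denom) :
  locfrac m s + locfrac n t =
  locfrac (val t *: m + val s *: n) (denom_mul s t).
Proof. exact: locmod_addE. Qed.

Lemma locfrac0 : locfrac 0 denom_one = 0. Proof. by []. Qed.

End LocalizedGroup.

Section LocalizedRing.
Variables (R : comNzRingType) (S : mulrClosed R).

(* S^-1 R, with the underlying additive group of S^-1 (R as an R-module) *)
Definition locring := locmod S R^o.

HB.instance Definition _ := GRing.Zmodule.on locring.

Definition locring_one : locring := locfrac (1 : R^o) (denom_one S).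

(* (a / s) (m / t) = (a m) / (s t); with M = R^o this is the product of S^-1 R *)
Definition locmod_scale (M : lmodType R) (a : locring) (x : locmod S M) :
    locmod S M :=
  locfrac (((repr a).1 : R) *: (repr x).1) (denom_mul (repr a).2 (repr x).2).

Definition locring_mul (a b : locring) : locring :=
  @locmod_scale R^o a b.

Lemma locmod_scaleE (M : lmodType R) (a : R) (m : M) (s t : denom S) :
  locmod_scale (locfrac (a : R^o) s) (locfrac m t) =
  locfrac (a *: m) (denom_mul s t).
Proof.
rewrite /locmod_scale.
have [u uS e] := repr_locfrac (a : R^o) s; have [v vS f] := repr_locfrac m t.
move: (repr (locfrac _ s)) (repr (locfrac _ t)) e f => [a' [s' s'S]] [m' [t' t'S]] /= e f.
apply/locfracP; exists (u * v); first exact: rpredM.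
case: s t e f => [s sS] [t tS] /= e f.
have -> : (u * v) *: ((s * t) *: (a' *: m')) =
   (u * (s * a')) *: (v *: (t *: m')).
  by rewrite !scalerA; congr (_ *: _); ring.
have -> : u * (s * a') = u * (s' * a) by exact: e.
by rewrite f !scalerA; congr (_ *: _); ring.
Qed.

Lemma locmod_scaleA (M : lmodType R) (a b : locring) (x : locmod S M) :
  locmod_scale a (locmod_scale b x) = locmod_scale (locring_mul a b) x.
Proof.
have [r [s ->]] := locfrac_surj a; have [q [t ->]] := locfrac_surj b.
have [m [w ->]] := locfrac_surj x.
rewrite (locmod_scaleE q m t w) (locmod_scaleE r (q *: m)).
rewrite /locring_mul (locmod_scaleE r q s t) (locmod_scaleE (r * q) m).
apply/locfracP; exists 1; first exact: rpred1.
by rewrite /= !scalerA; congr (_ *: _); ring.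
Qed.

Lemma locmod_scale1 (M : lmodType R) (x : locmod S M) :
  locmod_scale locring_one x = x.
Proof.
have [m [w ->]] := locfrac_surj x.
rewrite locmod_scaleE; apply/locfracP; exists 1; first exact: rpred1.
by rewrite /= !scale1r mul1r.
Qed.

Lemma locmod_scaleDr (M : lmodType R) (a : locring) (x y : locmod S M) :
  locmod_scale a (x + y) = locmod_scale a x + locmod_scale a y.
Proof.
have [r [s ->]] := locfrac_surj a.
have [m [w ->]] := locfrac_surj x; have [n [t ->]] := locfrac_surj y.
rewrite locfracD locmod_scaleE (locmod_scaleE r m) (locmod_scaleE r n) locfracD.
apply/locfracP.
exists 1; first exact: rpred1.
rewrite /= !(scalerDr, scalerA).
by congr (_ *: _ + _ *: _); ring.
Qed.

Lemma locmod_scaleDl (M : lmodType R) (x : locmod S M) (a b : locring) :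
  locmod_scale (a + b) x = locmod_scale a x + locmod_scale b x.
Proof.
have [r [s ->]] := locfrac_surj a; have [q [t ->]] := locfrac_surj b.
have [m [w ->]] := locfrac_surj x.
have -> : locfrac r s + locfrac q t = locfrac
    (val t * r + val s * q : R^o) (denom_mul s t) :> locring.
  exact: locfracD.
rewrite (locmod_scaleE r m) (locmod_scaleE q m).
rewrite (locmod_scaleE (val t * r + val s * q) m) locfracD; apply/locfracP.
exists 1; first exact: rpred1.
rewrite /= !(scalerDr, scalerA) -scalerDl.
by congr (_ *: _); ring.
Qed.

Lemma locring_mulC : commutative locring_mul.
Proof.
move=> a b; have [r [s ->]] := locfrac_surj a.
have [q [t ->]] := locfrac_surj b.
rewrite /locring_mul (locmod_scaleE r q s t) (locmod_scaleE q r t s).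
apply/locfracP; exists 1; first exact: rpred1.
by rewrite [r *: _]mulrC [val (denom_mul t s)]mulrC.
Qed.

Lemma locring_mulA : associative locring_mul.
Proof. by move=> a b c; apply: locmod_scaleA. Qed.

Lemma locring_mul1 : left_id locring_one locring_mul.
Proof. by move=> a; apply: locmod_scale1. Qed.

Lemma locring_mulDl : left_distributive locring_mul +%R.
Proof. by move=> a b c; apply: locmod_scaleDl. Qed.

HB.instance Definition _ := GRing.Zmodule_isComPzRing.Build locring
  locring_mulA locring_mulC locring_mul1 locring_mulDl.

HB.instance Definition _ (M : lmodType R) :=
  GRing.Zmodule_isLmodule.Build locring (locmod S M)
    (@locmod_scaleA M) (@locmod_scale1 M) (@locmod_scaleDr M)
    (@locmod_scaleDl M).

Lemma locfracZ (M : lmodType R) (a : R) (m : M) (s t : denom S) :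
  (locfrac (a : R^o) s : locring) *: locfrac m t =
  locfrac (a *: m) (denom_mul s t).
Proof. exact: locmod_scaleE. Qed.

Lemma locfracM (a b : R) (s t : denom S) :
  (locfrac (a : R^o) s : locring) * (locfrac (b : R^o) t : locring) =
  locfrac (a * b : R^o) (denom_mul s t).
Proof. exact: locmod_scaleE. Qed.

End LocalizedRing.

(* Main.v *)
(* If m / s is nonzero and does not generate S^-1 M, then m lies in M^#: were
   m a generator of M, m / s would generate S^-1 M.  So R m is simple, i.e. m is
   a multiple of each of its nonzero multiples a m.  This divisibility passes to
   fractions, and it characterises simple cyclic submodules. *)
Require Import Defs.
From HB Require Import structures.
From mathcomp Require Import all_boot all_algebra.
From mathcomp Require Import boolp classical_sets.
From mathcomp Require Import ring.

Import GRing.Theory.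

Local Open Scope ring_scope.
Local Open Scope classical_set_scope.

Lemma submod_closedZ (A : comPzRingType) (M : lmodType A) (L : set M)
    (a : A) (x : M) : submod_closed [in L] -> L x -> L (a *: x).
Proof.
move=> [L0 Llin] Lx; apply/set_mem.
by rewrite -[a *: x]addr0; apply: Llin => //; apply/mem_set.
Qed.

Lemma cyclic_submod_closed (A : comPzRingType) (M : lmodType A) (m : M) :
  submod_closed [in cyclic_submod m].
Proof.
split; first by apply/mem_set; exists 0; rewrite ?scale0r.
move=> a _ _ /set_mem[b _ <-] /set_mem[c _ <-]; apply/mem_set.
by exists (a * b + c); rewrite // scalerDl scalerA.
Qed.

Lemma cyclic_submod_id (A : comPzRingType) (M : lmodType A) (m : M) :
  cyclic_submod m m.
Proof. by exists 1; rewrite ?scale1r. Qed.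

(** Simplicity forces the nonzero submodule generated by [a *: m] to be all of [cyclic_submod m], so
    it contains [m]. Conversely, a nonzero submodule inside [cyclic_submod m] contains some
    [a *: m != 0], hence its multiple [m]. *)
Lemma simple_cyclicP (A : comPzRingType) (M : lmodType A) (m : M) : m != 0 ->
  simple_submod (cyclic_submod m) <->
  (forall a : A, a *: m != 0 -> exists b : A, b *: (a *: m) = m).
Proof.
move=> m_neq0; split=> [[_ _ simple_m] a am_neq0|div_m].
  have sub : cyclic_submod (a *: m) `<=` cyclic_submod m.
    by move=> _ [b _ <-]; exists (b * a); rewrite // scalerA.
  have [am0|amE] := simple_m _ (cyclic_submod_closed _ _ _) sub.
    have := cyclic_submod_id _ _ (a *: m).
    by rewrite am0 => /eqP; rewrite (negPf am_neq0).
  by have := cyclic_submod_id _ _ m; rewrite -amE => -[b _ bE]; exists b.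
split; first exact: cyclic_submod_closed.
  move=> m0; have := cyclic_submod_id _ _ m.
  by rewrite m0 => /eqP; rewrite (negPf m_neq0).
move=> L closedL subL.
have [[x [Lx x_neq0]]|L_eq0] := pselect (exists x, L x /\ x != 0).
  right; apply/seteqP; split=> // _ [c _ <-].
  have [a _ xE] := subL _ Lx.
  have [|b bE] := div_m a; first by rewrite xE.
  (* With [m] rewritten as [b *: x], the element [c *: m] becomes [c *: (b *: x)], a multiple of [x]
     in [L]. *)
  by rewrite -bE xE; do 2!apply: submod_closedZ => //.
left; apply/seteqP; split=> [x Lx|_ ->].
  by apply: contrapT => /eqP x_neq0; apply: L_eq0; exists x.
by apply/set_mem; case: closedL.
Qed.

Lemma locfrac_eq0 (R : comNzRingType) (S : mulrClosed R) (M : lmodType R)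
    (s : denom S) : locfrac (0 : M) s = 0.
Proof.
apply/locfracP; exists 1; first exact: rpred1.
by rewrite !scaler0.
Qed.

(** The factor [val s] in the scalar cancels the denominator of [locfrac m s], so any numerator in
    [R m] over any denominator [t] is reached. *)
Lemma locfrac_scale_num (R : comNzRingType) (S : mulrClosed R)
    (M : lmodType R) (r : R) (m : M) (s t : denom S) :
  (locfrac (r * val s : R^o) t : locring S) *: locfrac m s
    = locfrac (r *: m) t.
Proof.
rewrite locfracZ; apply/locfracP; exists 1; first exact: rpred1.
by rewrite /= !scalerA; congr (_ *: _); ring.
Qed.

Lemma cyclic_locfrac_setT (R : comNzRingType) (S : mulrClosed R)
    (M : lmodType R) (m : M) (s : denom S) :
  cyclic_submod m = [set: M] ->
  cyclic_submod (locfrac m s : locmod S M) = [set: locmod S M].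
Proof.
move=> genm; apply/seteqP; split=> // y _.
have [n [t ->]] := locfrac_surj y.
have [r _ <-] : cyclic_submod m n by rewrite genm.
by exists (locfrac (r * val s : R^o) t) => //; apply: locfrac_scale_num.
Qed.

Theorem theorem8 (R : comNzRingType) (M : lmodType R) (S : mulrClosed R) :
  pseudo_simple M ->
  (forall m : M, nz_nongen M m -> annihilator m `&` [set` S] = set0) ->
  pseudo_simple (locmod S M : lmodType (locring S)).
Proof.
move=> psM _ x [x_neq0 x_nongen].
apply/(simple_cyclicP _ _ _ x_neq0).
have [m [s xE]] := locfrac_surj x; rewrite {}xE in x_neq0 x_nongen *.
have m_neq0 : m != 0.
  by apply: contra_neq x_neq0 => ->; apply: locfrac_eq0.
have /psM/(simple_cyclicP _ _ _ m_neq0) div_m : nz_nongen M m.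
  by split=> // /cyclic_locfrac_setT gen; apply: x_nongen.
move=> y; have [a [t ->]] := locfrac_surj y; rewrite locfracZ => am_neq0.
(* The numerator [a *: m] is nonzero because the fraction over it is, so divisibility in [M]
   applies. *)
have [|b bE] := div_m a.
  by apply: contra_neq am_neq0 => ->; apply: locfrac_eq0.
(* The scalar clears the denominator [t s] of the multiple and restores [s], giving
   [b (a m) / s = m / s]. *)
exists (locfrac (b * val (denom_mul t s) : R^o) s).
by rewrite locfrac_scale_num bE.
Qed.
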